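(* Let $m\ge 3$ be an odd integer and let $G$ be isomorphic to the dihedral group $D_{2m}=\langle a,b : a^m=b^2=1,\ bab^{-1}=a^{-1}\rangle$. Then the signless Laplacian spectrum of the non-commuting graph $\Gamma_G$ is $$\left\{(m)^{m-2},\ (2m-3)^{m-1},\ \left(\tfrac{4m-3+\sqrt{8m^2-16m+9}}{2}\right)^1,\ \left(\tfrac{4m-3-\sqrt{8m^2-16m+9}}{2}\right)^1\right\}$$ and its signless Laplacian energy is $$LE^+(\Gamma_G)=\begin{cases}\frac{9}{5}+\sqrt{33}, & \text{if } m=3,\\[2pt] \frac{2m^3-10m^2+12m-3}{2m-1}+\sqrt{8m^2-16m+9}, & \text{if } m\ge 5.\end{cases}$$
   Context: For a finite non-abelian group $G$ with center $Z(G)$, the non-commuting graph $\Gamma_G$ is the simple undirected graph with vertex set $G\setminus Z(G)$ in which $x,y$ are adjacent iff $xy\ne yx$. For a finite simple graph $\mathcal G$ with vertex set $v(\mathcal G)$, edge set $e(\mathcal G)$, adjacency matrix $A(\mathcal G)$ and diagonal degree matrix $D(\mathcal G)$, the signless Laplacian matrix is $Q(\mathcal G)=D(\mathcal G)+A(\mathcal G)$, and its signless Laplacian spectrum is the multiset of eigenvalues of $Q(\mathcal G)$. The notation $\{(\gamma_1)^{d_1},\dots,(\gamma_l)^{d_l}\}$ means the multiset in which $\gamma_r$ is listed $d_r$ times (coinciding listed values have their multiplicities added). The signless Laplacian energy is $LE^+(\mathcal G)=\sum_{\gamma}\left|\gamma-\frac{2|e(\mathcal G)|}{|v(\mathcal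 G)|}\right|$, the sum being over the signless Laplacian spectrum with multiplicity. *)

(* Defs.v *)
From HB Require Import structures.
From mathcomp Require Import all_boot all_order all_algebra.
From mathcomp Require Import all_fingroup all_solvable.

Set Implicit Arguments.
Unset Strict Implicit.
Unset Printing Implicit Defensive.

Import Order.TTheory GRing.Theory Num.Theory.

Local Open Scope ring_scope.

Record sgraph := SGraph {
  vertex :> finType;
  adj : rel vertex;
  adj_sym : symmetric adj;
  adj_irrefl : irreflexive adj
}.

Definition edges (g : sgraph) : {set {set g}} :=
  [set [set p.1; p.2] | p : g * g & adj p.1 p.2].

Definition degree (g : sgraph) (x : g) : nat := #|[set y | adj x y]|.

Section GraphMatrices.

Variables (C : numClosedFieldType) (g : sgraph).

(* Matrix rows and columns are numbered by the library enumeration of the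
   vertex type. *)
Definition adjacency_mx : 'M[C]_#|g| :=
  \matrix_(i, j) (adj (enum_val i) (enum_val j))%:R.

Definition degree_mx : 'M[C]_#|g| :=
  diag_mx (\row_i (degree (enum_val i))%:R).

Definition signless_laplacian : 'M[C]_#|g| := degree_mx + adjacency_mx.

End GraphMatrices.

(* The eigenvalues of A, with multiplicity, as the roots of its characteristic
   polynomial; the order of the sequence is irrelevant, so spectra are to be
   compared with [perm_eq]. *)
Definition spectrum (C : numClosedFieldType) n (A : 'M[C]_n) : seq C :=
  sval (closed_field_poly_normal (char_poly A)).

Lemma spectrumP (C : numClosedFieldType) n (A : 'M[C]_n) :
  char_poly A = \prod_(z <- spectrum A) ('X - z%:P).
Proof.
rewrite /spectrum; case: closed_field_poly_normal => s /= {1}->.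
by rewrite (eqP (char_poly_monic A)) scale1r.
Qed.

Definition Q_spectrum (C : numClosedFieldType) (g : sgraph) : seq C :=
  spectrum (signless_laplacian C g).

Definition Q_energy (C : numClosedFieldType) (g : sgraph) : C :=
  \sum_(z <- Q_spectrum C g) `|z - (2 * #|edges g|)%N%:R / #|g|%:R|.

Section NonCommutingGraph.

Variables (gT : finGroupType) (G : {group gT}).

Definition nc_vertex : finType := {x : gT | x \in G :\: 'Z(G)%g}.

Definition nc_adj : rel nc_vertex :=
  fun x y => (val x * val y != val y * val x)%g.

Lemma nc_adj_sym : symmetric nc_adj.
Proof. by move=> x y; rewrite /nc_adj eq_sym. Qed.

Lemma nc_adj_irrefl : irreflexive nc_adj.
Proof. by move=> x; rewrite /nc_adj eqxx. Qed.

Definition non_commuting_graph : sgraph := SGraph nc_adj_sym nc_adj_irrefl.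

End NonCommutingGraph.

(* Main.v *)
(** The rotations R of G form an abelian subgroup of index 2 and odd order m,
    inverted by every element outside R.  Since no nontrivial rotation is its
    own inverse, two distinct nontrivial elements of G commute exactly when
    both lie in R; hence the center is trivial and the non-commuting graph is a
    complete split graph: the m - 1 nontrivial rotations are pairwise
    non-adjacent, and the m reflections are adjacent to every other vertex.
    For such a graph X - Q is a diagonal matrix with two distinct values minus
    a matrix of rank at most 2, so the matrix determinant lemma reduces the
    characteristic polynomial to a 2 x 2 determinant.  The energy follows by
    comparing each eigenvalue with the mean degree 3m(m-1)/(2m-1): m lies
    below it, 2m - 3 lies above it exactly when m >= 5, and the two remaining
    eigenvalues lie on either side of it. *)

Require Import Defs.
From mathcomp Require Import all_boot all_order all_algebra.
From mathcomp Require Import all_fingroup all_solvable ring zify.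

Set Implicit Arguments.
Unset Strict Implicit.
Unset Printing Implicit Defensive.

Import Order.TTheory GRing.Theory Num.Theory.

(** * Commutation in odd dihedral groups *)

Section OddDihedral.

Local Open Scope group_scope.

(** The presentation provides generators [x] and [y], and [R] is [<[x]>]. An element outside [R] is
    [r * y] with [r] in [R]; since [R] is abelian, it acts on [R] as [y] does, by inversion. *)
Lemma odd_dihedral_rotations (gT : finGroupType) (G : {group gT}) m :
    1 < m -> odd m -> G \isog 'D_(2 * m) ->
  exists R : {group gT}, [/\ R \subset G, abelian R, #|R| = m, #|G : R| = 2 &
    {in R & G :\: R, forall z g, z ^ g = z^-1}].
Proof.
move=> m_gt1 m_odd; rewrite mul2n => isoG.
have m_gt0 := ltnW m_gt1.
have /(isoGrpP _ (Grp_dihedral m_gt1))[oG] := isoG.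
case/existsP=> -[x y] /= /eqP[defG xm y2 xy].
move: oG; rewrite card_dihedral // => oG.
have {}defG : <[x]> * <[y]> = G.
  by rewrite -norm_joinEr // norms_cycle xy groupV cycle_id.
have ox_dvd : #[x] %| m by rewrite order_dvdn xm.
have oy_dvd : #[y] %| 2 by rewrite order_dvdn y2.
have Gx : <[x]> \subset G by rewrite -defG mulG_subl.
have Gy : y \in G by rewrite -cycle_subG -defG mulG_subr.
have tiXY : <[x]> :&: <[y]> = 1.
  apply/coprime_TIg/(coprime_dvdl ox_dvd)/(coprime_dvdr oy_dvd).
  by rewrite coprimen2.
(* The order of [x] divides [m]. It is at least [m] because 2m = |G| is the product of the orders of
   [x] and [y], and the latter is at most 2. *)
have oX : #|<[x]>| = m.
  apply/eqP; rewrite eqn_leq dvdn_leq //= -(leq_pmul2r (ltn0Sn 1)).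
  rewrite muln2 -oG -defG (TI_cardMg tiXY).
  by rewrite leq_mul2l orbC (dvdn_leq _ oy_dvd).
have iX : #|G : <[x]>| = 2 by rewrite -divgS // oG oX -muln2 mulKn.
exists <[x]>%G; split=> //; first exact: cycle_abelian.
have X'y : y \in G :\: <[x]>.
  rewrite inE Gy andbT; apply/negP => Xy; have /eqP := iX.
  have -> : G = <[x]>%G.
    by apply/val_inj; rewrite /= -defG mulGSid // cycle_subG.
  by rewrite indexgg.
move=> z g Xz; rewrite -(rcoset_index2 Gx iX X'y) => /rcosetP[r Xr ->].
rewrite conjgM (conjgE z) (centsP (cycle_abelian x) _ Xz _ Xr) mulKg.
by case/cycleP: Xz => i ->; rewrite conjXg xy expgVn.
Qed.

Section GeneralizedDihedral.

Variables (gT : finGroupType) (G R : {group gT}).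
Hypotheses (sRG : R \subset G) (abR : abelian R) (oddR : odd #|R|).
Hypotheses (R_gt1 : 1 < #|R|) (iR : #|G : R| = 2).
Hypothesis invR : {in R & G :\: R, forall z g, z ^ g = z^-1}.

(** Commuting with [g] forces [z] to equal its inverse, so the order of [z] divides both 2 and the
    odd number [#|R|]. *)
Lemma inverted_commuteP z g :
  z \in R -> g \in G :\: R -> (z * g == g * z) = (z == 1).
Proof.
move=> Rz R'g; rewrite conjgC (inj_eq (mulgI g)) invR //.
rewrite eq_invg_mul -expg2 -order_dvdn.
apply/idP/eqP=> [o2 | ->]; last by rewrite order1.
apply/eqP; rewrite -order_eq1 -dvdn1 -(eqP (_ : coprime 2 #|R|)) ?coprime2n //.
by rewrite dvdn_gcd o2 order_dvdG.
Qed.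

Lemma inverted_nc_edge : {in G^# &, forall g h,
  (g * h != h * g) = (g != h) && ~~ ((g \in R) && (h \in R))}.
Proof.
move=> g h /setD1P[ntg Gg] /setD1P[nth Gh].
have [-> | neq_gh] := eqVneq g h; first by rewrite eqxx.
have R'I k : k \in G -> k \notin R -> k \in G :\: R by rewrite inE => -> ->.
have [Rg | R'g] := boolP (g \in R); have [Rh | R'h] := boolP (h \in R) => /=.
- by rewrite (centsP abR _ Rg _ Rh) eqxx.
- by rewrite inverted_commuteP ?R'I.
- by rewrite eq_sym inverted_commuteP ?R'I.
(* Two reflections lie in the same coset of [R]. If they commuted, the nontrivial rotation
   [g * h^-1] would commute with [h]. *)
have Rgh : g * h^-1 \in R.
  move: (R'I g Gg R'g); rewrite -(rcoset_index2 sRG iR (R'I h Gh R'h)).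
  by rewrite mem_rcoset.
have := inverted_commuteP Rgh (R'I h Gh R'h).
rewrite -eq_mulgV1 (negPf neq_gh) => /negbT.
by rewrite mulgKV mulgA; apply: contraNneq => <-; rewrite mulgK.
Qed.

(** A central rotation commutes with some reflection, hence is trivial; a central element outside
    [R] would commute with a nontrivial rotation. *)
Lemma inverted_center1 : 'Z(G) = 1.
Proof.
apply/trivgP/subsetP=> z /setIP[Gz /centP cGz]; rewrite inE.
have [Rz | R'z] := boolP (z \in R).
  have /subsetPn[g Gg R'g] : ~~ (G \subset R) by rewrite -indexg_eq1 iR.
  by rewrite -(inverted_commuteP Rz (g := g)) ?cGz // inE R'g.
have /trivgPn[w Rw] : R :!=: 1 by rewrite -cardG_gt1.
rewrite -(inverted_commuteP Rw (g := z)) ?cGz ?eqxx ?inE ?R'z //.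
exact: (subsetP sRG).
Qed.

Definition nc_rotations : {set non_commuting_graph G} :=
  [set v : nc_vertex G | val v \in R].

Lemma card_nc_vertex_set (B : {set gT}) :
  #|[set v : nc_vertex G | val v \in B]| = #|(G :\: 'Z(G)) :&: B|.
Proof.
rewrite -(card_imset _ val_inj); apply: eq_card => x.
apply/imsetP/setIP=> [[v] | [Vx Bx]].
  by rewrite inE => Bv ->; split=> //; exact: (valP v).
by exists (Sub x Vx); rewrite ?inE SubK.
Qed.

Lemma card_nc_rotations : #|nc_rotations| = #|R|.-1.
Proof.
rewrite card_nc_vertex_set inverted_center1 setIDAC (setIidPr sRG).
by rewrite [in RHS](cardsD1 1 R) group1.
Qed.

Lemma card_nc_rotationsC : #|~: nc_rotations| = #|R|.
Proof.
have -> : ~: nc_rotations = [set v : nc_vertex G | val v \in ~: R].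
  by apply/setP=> v; rewrite !inE.
rewrite card_nc_vertex_set inverted_center1.
have -> : G^# :&: ~: R = G :\: R.
  apply/setP=> x; rewrite !inE andbC andbA; case: (boolP (x \in R)) => //= R'x.
  by case: eqP R'x => // ->; rewrite group1.
by rewrite cardsD (setIidPr sRG) -(Lagrange sRG) iR muln2 -addnn addnK.
Qed.

(** This supplies the hypothesis [adjE] of the section on complete split graphs. *)
Lemma nc_rotations_adj (x y : non_commuting_graph G) :
  adj x y = (x != y) && ~~ ((x \in nc_rotations) && (y \in nc_rotations)).
Proof.
have inG1 (v : nc_vertex G) : val v \in G^#.
  by rewrite -(congr1 (setD G) inverted_center1); exact: (valP v).
by rewrite /= /nc_adj inverted_nc_edge // !inE (inj_eq val_inj).
Qed.

End GeneralizedDihedral.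

End OddDihedral.

Local Open Scope ring_scope.

(** * Determinants of diagonal matrices minus low-rank ones *)

Lemma det_mx2 (R : comPzRingType) (A : 'M[R]_2) :
  \det A = A 0 0 * A 1 1 - A 0 1 * A 1 0.
Proof.
rewrite (expand_det_row _ 0) !big_ord_recl big_ord0 /cofactor !det_mx11 !mxE /=.
rewrite expr0 expr1 addr0 mul1r mulN1r mulrN.
by congr (A _ _ * A _ _ - A _ _ * A _ _); apply/val_inj.
Qed.

Lemma det_diag_sub_mul (F : fieldType) n k (d : 'rV[F]_n)
    (U : 'M_(n, k)) (W : 'M_(k, n)) : (forall i, d 0 i != 0) ->
  \det (diag_mx d - U *m W) =
    \prod_i d 0 i * \det (1%:M - W *m diag_mx (\row_i (d 0 i)^-1) *m U).
Proof.
(* Both sides are the determinant of the block matrix [[1, W], [U, D]]. *)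
move=> nz_d; set D := diag_mx d; set E := diag_mx _.
have ED : D *m E = 1%:M.
  rewrite mulmx_diag; apply/matrixP=> i j; rewrite !mxE.
  by case: eqP => // ->; rewrite mulfV.
have DE : E *m D = 1%:M by rewrite diag_mxC.
have L : block_mx 1%:M W U D =
    block_mx 1%:M 0 U 1%:M *m block_mx 1%:M W 0 (D - U *m W).
  rewrite mulmx_block !(mul1mx, mul0mx, mulmx1, mulmx0, addr0).
  by rewrite addrC subrK.
have R : block_mx 1%:M W U D =
    block_mx (1%:M - W *m E *m U) (W *m E) 0 1%:M *m block_mx 1%:M 0 U D.
  rewrite mulmx_block !(mul1mx, mul0mx, mulmx1, mulmx0, add0r) subrK.
  by rewrite -mulmxA DE mulmx1.
have := congr1 determinant L; rewrite {1}R !det_mulmx !det_lblock !det_ublock.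
by rewrite !det1 !mul1r mulr1 det_diag mulrC => <-.
Qed.

(** The factor [a * b] on the left clears the denominators of the 2 x 2 determinant. *)
Lemma det_split_mx (F : fieldType) n (S : {set 'I_n}) (a b : F) :
    a != 0 -> b != 0 ->
  \det (\matrix_(i, j) ((if i \in S then a else b) *+ (i == j)
                         - (~~ ((i \in S) && (j \in S)))%:R)) * (a * b) =
    a ^+ #|S| * b ^+ #|~: S| * (a * b - #|~: S|%:R * (a + #|S|%:R)).
Proof.
move=> nz_a nz_b; set s := #|S|; set t := #|~: S|.
pose d := \row_(i < n) (if i \in S then a else b).
(* [U *m W] is the all-ones matrix minus the all-ones block on [S]. *)
pose U : 'M[F]_(n, 2) := \matrix_(i, k) (if k == 0 then 1 else (i \in S)%:R).
pose W : 'M[F]_(2, n) := \matrix_(k, i) (if k == 0 then 1 else - (i \in S)%:R).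
rewrite (_ : \matrix_(i, j) _ = diag_mx d - U *m W); last first.
  apply/matrixP=> i j; rewrite !mxE !big_ord_recl big_ord0 !mxE /= addr0 mul1r.
  by congr (_ - _); case: (i \in S); case: (j \in S) => /=; ring.
have sumE (f : bool -> F) :
    \sum_i f (i \in S) = s%:R * f true + t%:R * f false.
  rewrite (bigID [in S]) /=.
  rewrite (eq_bigr (fun=> f true)) => [|i /= ->//].
  rewrite [in X in _ + X](eq_bigr (fun=> f false)) => [|i /= /negPf->//].
  rewrite !sumr_const !mulr_natl; congr (_ *+ _ + _ *+ _).
  by apply: eq_card => i; rewrite !inE.
have prodE : \prod_i d 0 i = a ^+ s * b ^+ t.
  rewrite (bigID [in S]) /=.
  rewrite (eq_bigr (fun=> a)) => [|i Si]; last by rewrite mxE Si.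
  rewrite [in X in _ * X](eq_bigr (fun=> b)) => [|i /negPf S'i]; last first.
    by rewrite mxE S'i.
  rewrite !prodr_const; congr (_ ^+ _ * _ ^+ _).
  by apply: eq_card => i; rewrite !inE.
rewrite det_diag_sub_mul => [|i]; last by rewrite mxE; case: ifP.
have WEU k l : (W *m diag_mx (\row_i (d 0 i)^-1) *m U) k l =
    s%:R * (if k == 0 then 1 else -1) / a
    + (if (k == 0) && (l == 0) then t%:R / b else 0).
  pose f (v : bool) : F := (if k == 0 then 1 else - v%:R)
    * (if v then a else b)^-1 * (if l == 0 then 1 else v%:R).
  rewrite mxE (eq_bigr (fun i => f (i \in S))) => [|i _].
    by rewrite sumE /f; case: (k == 0); case: (l == 0) => /=; ring.
  by rewrite mul_mx_diag !mxE.
rewrite prodE det_mx2 !(WEU, mxE) /= mulr1n mulr0n.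
by field; rewrite nz_a nz_b.
Qed.

(** * Signless Laplacian spectrum of a complete split graph *)

Section CompleteSplitGraph.

Variables (C : numClosedFieldType) (g : sgraph) (S : {set g}).
Hypothesis adjE : forall x y : g,
  adj x y = (x != y) && ~~ ((x \in S) && (y \in S)).
Hypotheses (S_gt0 : (0 < #|S|)%N) (S'_gt0 : (0 < #|~: S|)%N).

Lemma split_degree (x : g) :
  degree x = if x \in S then #|~: S| else (#|S| + #|~: S|).-1.
Proof.
rewrite /degree; have [Sx | S'x] := ifPn.
  suff -> : [set y | adj x y] = ~: S by [].
  apply/setP=> y; rewrite !inE adjE Sx /= andbC.
  by case: (boolP (y \in S)) => //= S'y; apply: contraNneq S'y => <-.
suff -> : [set y | adj x y] = [set~ x] by rewrite cardsC1 cardsC.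
by apply/setP=> y; rewrite !inE adjE (negPf S'x) andbT eq_sym.
Qed.

Let s : nat := #|S|.
Let t : nat := #|~: S|.

Lemma split_char_poly :
  char_poly (signless_laplacian C g) =
    ('X - t%:R%:P) ^+ s.-1 * ('X - (s + t - 2)%:R%:P) ^+ t.-1 *
    ('X^2 - (s + 3 * t - 2)%:R *: 'X + (2 * t * t.-1)%:R%:P).
Proof.
(* det_split_mx inverts the diagonal entries, hence the fraction field. *)
pose f : {rmorphism {poly C} -> {fraction {poly C}}} := @tofrac {poly C}.
have f_inj : injective f by move=> p q /eqP; rewrite tofrac_eq => /eqP.
have fnat n : f n%:R%:P = n%:R by rewrite polyC_natr rmorph_nat.
have XsubC_neq0 (z : C) : f ('X - z%:P) != 0.
  by rewrite tofrac_eq0 polyXsubC_eq0.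
(* Vertices outside [S] have degree s + t - 1. The subtracted low-rank matrix has diagonal entry 1
   there, so [B] must add 1 back. *)
set A := 'X - t%:R%:P; set B := 'X - (s + t - 2)%:R%:P.
have nz_A : f A != 0 by exact: XsubC_neq0.
have nz_B : f B != 0 by exact: XsubC_neq0.
have AB0 : A * B != 0 by rewrite mulf_neq0 // polyXsubC_eq0.
apply: (mulIf AB0); apply: f_inj; rewrite rmorphM /char_poly -(det_map_mx f).
pose S' := enum_val (A := g) @^-1: S.
have card_pre (V : {set g}) : #|enum_val (A := g) @^-1: V| = #|V|.
  by apply: on_card_preimset; apply: onW_bij; exact: enum_val_bij.
rewrite (_ : map_mx f _ =
    \matrix_(i, j) ((if i \in S' then f A else f B) *+ (i == j)
                    - (~~ ((i \in S') && (j \in S')))%:R)); last first.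
  apply/matrixP=> i j.
  rewrite !mxE split_degree adjE (inj_eq enum_val_inj) !inE -/s -/t.
  rewrite rmorphB rmorphMn polyCD polyCMn.
  have [<- | _] := eqVneq i j; last first.
    by rewrite !mulr0n !add0r; congr (- _); exact: fnat.
  rewrite /= addr0 !mulr1n andbb; case: (_ \in S).
    by rewrite rmorphB subr0.
  rewrite (_ : (s + t).-1 = (s + t - 2).+1) /B; last by lia.
  by rewrite rmorphB !fnat -natr1 opprD addrA.
have := det_split_mx S' nz_A nz_B.
rewrite card_pre -preimsetC card_pre -/s -/t (rmorphM f A B) => ->.
have -> : f A ^+ s = f A ^+ s.-1 * f A by rewrite -exprSr prednK.
have -> : f B ^+ t = f B ^+ t.-1 * f B by rewrite -exprSr prednK.
rewrite -!fnat -!(rmorphXn, rmorphM, rmorphD, rmorphB); congr (f _).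
(* The factor [A * B - t * (A + s)] expands to the quadratic of the statement. *)
rewrite (_ : A ^+ s.-1 * A * _ * _ = A ^+ s.-1 * B ^+ t.-1 *
    (A * B - t%:R%:P * (A + s%:R%:P)) * (A * B)); last by ring.
congr (_ * _ * _); rewrite /A /B -mul_polyC !polyC_natr.
rewrite !natrB ?natrD ?natrM -?subn1 ?natrB //; [by ring|lia..].
Qed.

(** Here [r] is any square root of the discriminant of the quadratic factor. *)
Lemma split_Q_spectrum (r : C) :
    r ^+ 2 = (s + 3 * t - 2)%:R ^+ 2 - 8 * t%:R * (t%:R - 1) ->
  perm_eq (Q_spectrum C g)
    (nseq s.-1 t%:R ++ nseq t.-1 (s + t - 2)%:R ++
     [:: ((s + 3 * t - 2)%:R + r) / 2; ((s + 3 * t - 2)%:R - r) / 2]).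
Proof.
move=> r2; apply: prod_XsubC_eq; rewrite -spectrumP split_char_poly.
rewrite !big_cat !big_cons big_nil !big_nseq !iter_mulr_1 /= mulr1 mulrA.
set P : C := (s + 3 * t - 2)%:R in r2 *.
congr (_ * _).
have eP : P = (P + r) / 2 + (P - r) / 2 by field.
rewrite [in LHS]eP.
rewrite (_ : (2 * t * t.-1)%:R = (P + r) / 2 * ((P - r) / 2)); last first.
  rewrite (_ : _ * _ = (P ^+ 2 - r ^+ 2) / 4); last by field.
  by rewrite r2 !natrM -subn1 natrB //; field.
by rewrite -mul_polyC polyCD polyCM; ring.
Qed.

Lemma split_sum_degree : (\sum_(x : g) degree x = s * t + t * (s + t).-1)%N.
Proof.
rewrite (eq_bigr _ (fun x _ => split_degree x)) (bigID [in S]) /=.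
rewrite (eq_bigr (fun=> t)) => [|x /= ->//].
rewrite [X in (_ + X)%N](eq_bigr (fun=> (s + t).-1)) => [|x /= /negPf->//].
rewrite !sum_nat_const; congr (_ + _ * _)%N.
by apply: eq_card => x; rewrite !inE.
Qed.

End CompleteSplitGraph.

(** * Edge counting and an absolute value identity *)

Lemma sum_degree (g : sgraph) : (\sum_(x : g) degree x = 2 * #|edges g|)%N.
Proof.
pose h (p : g * g) := [set p.1; p.2].
pose A : {set g * g} := [set p | adj p.1 p.2].
have -> : (\sum_(x : g) degree x = \sum_(p in A) 1)%N.
  rewrite (eq_bigl (fun p => adj p.1 p.2)) => [|p]; last by rewrite inE.
  rewrite -(pair_big_dep xpredT (fun x y => adj x y) (fun _ _ => 1%N)) /=.
  by apply: eq_bigr => x _; rewrite sum1dep_card.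
(* Ordered adjacent pairs are grouped by their underlying edge; each fibre is [(x, y)] and
   [(y, x)]. *)
rewrite (partition_big_imset h) /= mulnC -sum_nat_const.
apply: eq_bigr => e /imsetP[[x y]]; rewrite inE /= => xy ->.
have neq_xy : x != y by apply: contraTneq xy => ->; rewrite adj_irrefl.
rewrite (eq_bigl [in [set (x, y); (y, x)]]) => [|[u v]].
  by rewrite sum1_card cards2 xpair_eqE negb_and neq_xy.
rewrite !inE !xpair_eqE /h /=.
apply/andP/orP=> [[uv /eqP/setP Euv]|[]/andP[/eqP-> /eqP->]]; last 2 first.
- by split.
- by rewrite adj_sym setUC.
have /set2P[] : u \in [set x; y] by rewrite -Euv set21.
all: have /set2P[] : v \in [set x; y] by rewrite -Euv set22.
all: by move=> ev eu; rewrite ev eu ?adj_irrefl // in uv *; rewrite ?eqxx; auto.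
Qed.

(** It is applied to the two irrational eigenvalues, whose deviations from the mean degree are
    [d + r / 2] and [d - r / 2]. *)
Lemma norm_addB_sum (R : numDomainType) (d r : R) :
  0 <= d -> 0 <= r -> d ^+ 2 <= r ^+ 2 -> `|d + r| + `|d - r| = r *+ 2.
Proof.
move=> d_ge0 r_ge0; rewrite ler_sqr ?nnegrE // => le_dr.
rewrite ger0_norm ?addr_ge0 // ler0_norm ?subr_le0 //.
by rewrite opprB addrC addrA subrK.
Qed.

(** * Spectrum and energy for odd dihedral groups *)

Theorem theorem2p2 (C : numClosedFieldType) (gT : finGroupType)
    (G : {group gT}) (m : nat) (m_ge3 : (3 <= m)%N) (m_odd : odd m)
    (isoG : G \isog 'D_(2 * m)%N) :
  let M : C := m%:R in
  let r : C := sqrtC (8 * M ^+ 2 - 16 * M + 9) in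
  perm_eq (Q_spectrum C (non_commuting_graph G))
    (nseq (m - 2)%N M ++ nseq (m - 1)%N (2 * M - 3) ++
     [:: (4 * M - 3 + r) / 2; (4 * M - 3 - r) / 2])
  /\ (m = 3%N ->
      Q_energy C (non_commuting_graph G) = 9 / 5 + sqrtC 33)
  /\ ((5 <= m)%N ->
      Q_energy C (non_commuting_graph G) =
        (2 * M ^+ 3 - 10 * M ^+ 2 + 12 * M - 3) / (2 * M - 1) + r).
Proof.
move=> M r; have m_gt1 : (1 < m)%N by exact: ltnW.
have [R [sRG abR oR iR invR]] := odd_dihedral_rotations m_gt1 m_odd isoG.
have oddR : odd #|R| by rewrite oR.
have R_gt1 : (1 < #|R|)%N by rewrite oR.
set g := non_commuting_graph G; pose S : {set g} := nc_rotations G R.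
have adjS := nc_rotations_adj sRG abR oddR R_gt1 iR invR.
have cS : #|S| = m.-1 by rewrite -oR; exact: card_nc_rotations.
have cS' : #|~: S| = m by rewrite -[RHS]oR; exact: card_nc_rotationsC.
have card_g : #|g| = (2 * m - 1)%N by rewrite -(cardsC S) cS cS'; lia.
have edges_g : (2 * #|edges g| = 3 * m * m.-1)%N.
  by rewrite -sum_degree (split_sum_degree adjS) cS cS'; nia.
have S_gt0 : (0 < #|S|)%N by rewrite cS; lia.
have S'_gt0 : (0 < #|~: S|)%N by rewrite cS'; lia.
have [k mk] : exists k, m = k.+3 by exists (m - 3)%N; lia.
(* In terms of K = m - 3 >= 0 the polynomials whose sign is needed have
   nonnegative coefficients, so they are images of natural numbers. *)
pose K : C := k%:R.
have K_ge0 : 0 <= K by exact: ler0n.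
have eM : M = K + 3 by rewrite /M mk -addn3 natrD.
have r2 : r ^+ 2 = 8 * M ^+ 2 - 16 * M + 9 by rewrite sqrtCK.
have spec : perm_eq (Q_spectrum C g)
    (nseq (m - 2)%N M ++ nseq (m - 1)%N (2 * M - 3) ++
     [:: (4 * M - 3 + r) / 2; (4 * M - 3 - r) / 2]).
  have := split_Q_spectrum adjS S_gt0 S'_gt0 (r := r).
  rewrite cS cS' -/M (_ : (m - 2)%N = m.-2) ?subn1; last by lia.
  rewrite (_ : (m.-1 + 3 * m - 2)%:R = 4 * M - 3 :> C); last first.
    rewrite (_ : (_ - _)%N = (4 * k + 9)%N); last by lia.
    by rewrite natrD natrM -/K eM; ring.
  rewrite (_ : (m.-1 + m - 2)%:R = 2 * M - 3 :> C); last first.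
    rewrite (_ : (_ - _)%N = (2 * k + 3)%N); last by lia.
    by rewrite natrD natrM -/K eM; ring.
  by apply; rewrite r2; ring.
(* [D] is the number of vertices, 2m - 1. *)
pose D : C := 2 * K + 5.
have D_gt0 : 0 < D by rewrite ltr_wpDl ?mulr_ge0 ?ltr0n.
have nz_D : 2 * K + 5 != 0 by rewrite gt_eqF.
pose mean : C := 3 * (K + 3) * (K + 2) / D.
have meanE : (2 * #|edges g|)%N%:R / #|g|%:R = mean.
  rewrite edges_g card_g mk (_ : (2 * k.+3 - 1)%N = (2 * k + 5)%N); last by lia.
  rewrite /= -addn2 -addn3 !(natrM, natrD) -/K /mean /D.
  by congr (_ / _); ring.
have r_ge0 : 0 <= r.
  rewrite sqrtC_ge0 (_ : _ + 9 = ((8 * k + 32) * k + 33)%:R) ?ler0n //.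
  by rewrite !(natrD, natrM) -/K eM; ring.
(* [d] is the midpoint (4m - 3)/2 of the two irrational eigenvalues minus the mean degree. *)
pose d : C := (2 * K ^+ 2 + 8 * K + 9) / (2 * D).
have d_ge0 : 0 <= d.
  apply: divr_ge0; last by rewrite mulr_ge0 // ltW.
  by rewrite !addr_ge0 ?mulr_ge0 ?exprn_ge0.
(* This places the mean degree between those two eigenvalues. *)
have le_dr : d ^+ 2 <= (r / 2) ^+ 2.
  rewrite -subr_ge0 expr_div_n r2 eM.
  rewrite (_ : _ - _ = ((((28 * k + 256) * k + 872) * k + 1316) * k + 744)%:R
      / (2 * D) ^+ 2).
    by rewrite divr_ge0 ?exprn_ge0 ?mulr_ge0 // ltW.
  by rewrite !(natrD, natrM) -/K /d /D; field.
have normM : `|M - mean| = (K + 3) * (K + 1) / D.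
  rewrite (_ : M - mean = - ((K + 3) * (K + 1) / D)); last first.
    by rewrite eM /mean /D; field.
  rewrite normrN ger0_norm //; apply: divr_ge0; last exact: ltW.
  by rewrite mulr_ge0 ?addr_ge0.
have energyE : Q_energy C g = (K + 1) * ((K + 3) * (K + 1) / D) +
    (K + 2) * `|2 * M - 3 - mean| + r.
  rewrite /Q_energy meanE (perm_big _ spec) !big_cat !big_cons big_nil.
  rewrite !big_nseq /= !iter_addr_0 normM addr0.
  rewrite -(mulr_natl _ (m - 2)) -(mulr_natl _ (m - 1)).
  rewrite (_ : (m - 2)%:R = K + 1); last by rewrite mk subn2 /= natr1.
  rewrite (_ : (m - 1)%:R = K + 2); last by rewrite mk subn1 /= -addn2 natrD.
  rewrite [LHS]addrA; congr (_ + _).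
  rewrite (_ : _ - mean = d + r / 2); last by rewrite eM /mean /d /D; field.
  rewrite (_ : _ - mean = d - r / 2); last by rewrite eM /mean /d /D; field.
  by rewrite (norm_addB_sum d_ge0 (divr_ge0 r_ge0 (ler0n _ 2))) // [RHS]splitr.
split=> //; split=> [m3 | m_ge5]; rewrite energyE.
  have k0 : k = 0%N by move: m3; rewrite mk => -[].
  have K0 : K = 0 by rewrite /K k0.
  have -> : r = sqrtC 33 by rewrite /r eM K0; congr sqrtC; ring.
  (* For m = 3 the eigenvalue 2m - 3 = 3 lies below the mean 18/5. *)
  rewrite (_ : _ - mean = - (3 / 5)); last by rewrite eM /mean /D K0; field.
  rewrite normrN ger0_norm ?divr_ge0 //.
  by congr (_ + _); rewrite /D K0; field.
congr (_ + _).
rewrite (_ : _ - mean = (K ^+ 2 + K - 3) / D); last first.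
  by rewrite eM /mean /D; field.
rewrite ger0_norm.
  have -> : 2 * M - 1 = D by rewrite eM /D; ring.
  by rewrite eM /D; field.
apply: divr_ge0; last by rewrite ltW.
have k_ge2 : (2 <= k)%N by rewrite mk in m_ge5.
(* [K ^+ 2 + K - 3] is negative at 0 and 1; expanded around 2 its coefficients are nonnegative. *)
have kj : K = (k - 2)%:R + 2 by rewrite /K -natrD subnK.
set j := (k - 2)%N in kj.
rewrite (_ : K ^+ 2 + K - 3 = ((j + 5) * j + 3)%:R) ?ler0n //.
by rewrite kj !(natrD, natrM); ring.
Qed.
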